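(* Let $\mathbf{A}$ be an $n\times n$ real symmetric matrix and $n_{\mathrm{v}}$ a positive integer. Suppose $\mathbf{v}_1,\dots,\mathbf{v}_{n_{\mathrm{v}}}$ are independent and uniformly distributed on the unit sphere $\mathcal{S}^{n-1}$, and set $\Psi_i=\Psi[\mathbf{A},\mathbf{v}_i]$. Then for all $x\in\mathbb{R}$ and $t>0$, $$\mathbb{P}\Big[\Big|\Phi[\mathbf{A}](x)-\tfrac{1}{n_{\mathrm{v}}}\textstyle\sum_{i=1}^{n_{\mathrm{v}}}\Psi_i(x)\Big|>t\Big]\le 2\exp\!\big(-n_{\mathrm{v}}(n+2)t^2\big),$$ and $$\mathbb{P}\Big[d_{\mathrm{KS}}\Big(\Phi[\mathbf{A}],\tfrac{1}{n_{\mathrm{v}}}\textstyle\sum_{i=1}^{n_{\mathrm{v}}}\Psi_i\Big)>t\Big]\le 2n\exp\!\big(-n_{\mathrm{v}}(n+2)t^2\big).$$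
   Context: For a symmetric matrix $\mathbf{A}$ and $x\in\mathbb{R}$, $\mathbb{1}[\mathbf{A}\le x]$ denotes the orthogonal projector onto the span of eigenvectors of $\mathbf{A}$ with eigenvalues $\le x$. The CESM is $\Phi[\mathbf{A}](x)=\frac1n\#\{i:\lambda_i[\mathbf{A}]\le x\}$, and the weighted CESM for a unit vector $\mathbf{v}$ is $\Psi[\mathbf{A},\mathbf{v}](x)=\mathbf{v}^{\mathsf T}\mathbb{1}[\mathbf{A}\le x]\mathbf{v}$. The Kolmogorov–Smirnov distance is $d_{\mathrm{KS}}(\mu,\nu)=\sup_x|\mu(x)-\nu(x)|$. *)

(* Defs.v *)
From HB Require Import structures.
From mathcomp Require Import all_boot all_order all_algebra.
From mathcomp Require Import all_classical all_reals all_analysis.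
Set Implicit Arguments. Unset Strict Implicit. Unset Printing Implicit Defensive.
Import Order.TTheory GRing.Theory Num.Theory.
Local Open Scope classical_set_scope.
Local Open Scope ring_scope.

Section CESM.
Variables (R : realType) (n : nat).

Definition eig_span_le (A : 'M[R]_n) (x : R) (u : 'cV[R]_n) : Prop :=
  exists k (a : 'I_k -> R) (w : 'I_k -> 'cV[R]_n),
    (forall i, a i <= x /\ A *m w i = a i *: w i) /\ u = \sum_(i < k) w i.

Definition is_spec_proj_le (A : 'M[R]_n) (x : R) (P : 'M[R]_n) : Prop :=
  P^T = P /\ P *m P = P /\ (forall u : 'cV[R]_n, P *m u = u <-> eig_span_le A x u).

Definition spec_proj_le (A : 'M[R]_n) (x : R) : 'M[R]_n :=
  xget 0 [set P | is_spec_proj_le A x P].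

Definition eigvals (A : 'M[R]_n) : seq R :=
  xget [::] [set s : seq R | size s = n /\
                 char_poly A = \prod_(r <- s) ('X - r%:P)].

Definition Phi (A : 'M[R]_n) (x : R) : R :=
  (count (fun r => r <= x) (eigvals A))%:R / n%:R.

Definition Psi (A : 'M[R]_n) (v : 'cV[R]_n) (x : R) : R :=
  ((v^T *m spec_proj_le A x) *m v) ord0 ord0.

Definition dKS (F G : R -> R) : R := sup (range (fun x => `|F x - G x|)).

Definition cV_borel : set (set 'cV[R]_n) :=
  <<s [set S | exists (j : 'I_n) (B : set R),
          measurable B /\ S = (fun w : 'cV[R]_n => w j ord0) @^-1` B] >>.

Section Prob.
Context {d : measure_display} {Omega : measurableType d}.
Variable (P : probability Omega R).

Definition random_vector (V : Omega -> 'cV[R]_n) : Prop :=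
  forall B, cV_borel B -> measurable (V @^-1` B).

(* V is uniformly distributed on the unit sphere S^{n-1}: it lies on the
   sphere almost surely and its law is invariant under all orthogonal maps
   (this characterizes the normalized surface measure). *)
Definition uniform_on_sphere (V : Omega -> 'cV[R]_n) : Prop :=
  P [set w | ((V w)^T *m V w) ord0 ord0 = 1] = 1%E /\
  forall Q : 'M[R]_n, Q^T *m Q = 1%:M ->
    forall B, cV_borel B ->
      P ((fun w => Q *m V w) @^-1` B) = P (V @^-1` B).

Definition mutually_independent (m : nat) (V : 'I_m -> Omega -> 'cV[R]_n) : Prop :=
  forall B : 'I_m -> set 'cV[R]_n, (forall i, cV_borel (B i)) ->
    P (\bigcap_(i in [set: 'I_m]) (V i @^-1` B i)) =
    (\prod_(i < m) P (V i @^-1` B i))%E.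

End Prob.
End CESM.

(* Main.v *)
(** In an orthonormal eigenbasis, Psi_i(x) is the sum X of the squares of k
    coordinates of a uniform point of the sphere, and Phi(x) = k / n.  Rotating
    in the plane (a, b), with a among the k coordinates and b not, leaves
    E[u_a u_b exp(l X)] unchanged; differentiating in the angle and summing over
    (a, b) gives the Stein identity
      E[(n X - k) exp(l X)] = 2 l E[X (1 - X) exp(l X)].
    For h = psi'/psi with psi(l) = E[exp(l X)] it reads
      l h' + (n/2) (h - k/n) = l h (1 - h) <= l / 4,
    so that l^(n/2) (h - k/n - l / (2 (n+2))) is nonincreasing for l > 0, whence
    psi(l) <= exp(k l / n + l^2 / (4 (n+2))).  Exchanging the k coordinates with
    the others covers l < 0.  Chernoff's bound gives the pointwise estimate, and
    the Kolmogorov-Smirnov distance is a maximum over the n eigenvalues. *)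
Require Import Defs.
From HB Require Import structures.
From mathcomp Require Import all_boot all_order all_algebra.
From mathcomp Require Import spectral complex.
From mathcomp Require Import all_classical all_reals all_analysis.
From mathcomp Require Import measurable_realfun ring lra.
Set Implicit Arguments. Unset Strict Implicit. Unset Printing Implicit Defensive.
Import Order.TTheory GRing.Theory Num.Theory.
Import numFieldNormedType.Exports.
Local Open Scope classical_set_scope.
Local Open Scope ring_scope.

(** * Spectral theorem and the projectors *)

(** Over [R[i]] the matrix is hermitian, hence unitarily diagonalizable with real diagonal. A
    diagonal entry is a root of the characteristic polynomial; as this polynomial has coefficients
    in [R], the root is already an eigenvalue over [R]. *)
Lemma symmetric_eigenvector (R : rcfType) n (A : 'M[R]_n.+1) : A^T = A ->
  exists (a : R) (u : 'rV_n.+1), u != 0 /\ u *m A = a *: u.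
Proof.
move=> As.
pose AC : 'M[R[i]]_n.+1 := map_mx (real_complex R) A.
have AH : AC \is hermsymmx.
  apply: realsym_hermsym.
    by apply/is_hermitianmxP; apply/matrixP => i j; rewrite !mxE expr0 mul1r -[in LHS]As mxE.
  by apply/mxOverP => i j; rewrite mxE /real_complex_def complex_real.
have AN := hermitian_normalmx AH.
have AE := orthomx_spectralP AN.
have := hermitian_spectral_diag_real AH => /mxOverP /(_ 0 0).
set dg := spectral_diag AC 0 0 => dgR.
have : eigenvalue AC dg.
  apply/eigenvalueP; exists (row 0 (spectralmx AC)); last first.
    apply/eqP => r0; have := spectral_unit AC.
    rewrite -row_free_unit -kermx_eq0 => /eqP k0.
    have : (delta_mx 0 0 : 'rV_n.+1) *m spectralmx AC = 0 by rewrite -rowE.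
    move=> /sub_kermxP; rewrite k0 submx0 => /eqP/matrixP/(_ 0 0)/eqP.
    by rewrite !mxE !eqxx oner_eq0.
  rewrite -row_mul {2}AE !mulmxA mulmxV ?spectral_unit // mul1mx.
  by rewrite row_mul row_diag_mx -scalemxAl -rowE.
rewrite eigenvalue_root_char.
rewrite -(RRe_real dgR) /AC -map_char_poly fmorph_root -eigenvalue_root_char.
by case/eigenvalueP => u uA u0; exists (complex.Re dg), u.
Qed.

(** The reflection in the hyperplane orthogonal to [w = u - e] exchanges [u] and the first basis
    vector [e]. If [u = e] this hyperplane is undefined and the identity serves. *)
Lemma householder (R : rcfType) n (u : 'rV[R]_n.+1) : u *m u^T = 1%:M ->
  exists H : 'M[R]_n.+1, [/\ H^T = H, H *m H = 1%:M & row 0 H = u].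
Proof.
move=> u1; pose e : 'rV[R]_n.+1 := delta_mx 0 0.
have e1 : e *m e^T = 1%:M.
  apply/matrixP => i j; rewrite !ord1 !mxE (bigD1 ord0) //= big1 ?mxE ?eqxx ?mulr1 ?addr0 // => k k0.
  by rewrite !mxE (negPf k0) andbF mulr0.
have [ue|ue] := eqVneq u e.
  exists 1%:M; split; [exact: trmx1|exact: mul1mx|].
  by rewrite rowE mulmx1 ue.
have [w wE] : exists w, w = u - e by exists (u - e).
pose s := (w *m w^T) 0 0.
have ww : w *m w^T = s%:M by rewrite [LHS]mx11_scalar.
have s0 : s != 0.
  apply/eqP => s0; case/eqP: ue; apply/eqP; rewrite -subr_eq0 -wE; apply/eqP/rowP => j.
  move: s0; rewrite /s mxE => /eqP; rewrite psumr_eq0 => [|k _]; last by rewrite [w^T _ _]mxE -expr2 sqr_ge0.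
  move=> /allP /(_ j); rewrite mem_index_enum => /(_ isT) /=; rewrite [w^T _ _]mxE -expr2 sqrf_eq0 => /eqP.
  by move=> ->; rewrite mxE.
exists (1%:M - (2 / s) *: (w^T *m w)); split.
- by rewrite linearB /= trmx1 linearZ /= trmx_mul trmxK.
- have MM : (w^T *m w) *m (w^T *m w) = s *: (w^T *m w).
    by rewrite mulmxA -(mulmxA w^T) ww -mulmxA mul_scalar_mx -scalemxAr.
  move: (w^T *m w) MM => M MM.
  rewrite mulmxBl mul1mx mulmxBr mulmx1 -scalemxAl -scalemxAr MM !scalerA.
  by apply/matrixP => i j; rewrite !mxE; field.
- rewrite rowE mulmxBr mulmx1 -scalemxAr mulmxA -/e.
  (* Both vectors are unit, so |u - e|^2 = 2 - 2 u_0; thus e w^T = u_0 - 1 = - s / 2 and the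
     reflection sends [e] to e + w = u. *)
  have sE : s = 2 - 2 * u 0 0.
    have ue0 : (u *m e^T) = (u 0 0)%:M.
      by rewrite [LHS]mx11_scalar; congr (_%:M); rewrite trmx_delta -colE mxE.
    have eu0 : (e *m u^T) = (u 0 0)%:M by rewrite -[LHS]trmxK trmx_mul trmxK ue0 tr_scalar_mx.
    rewrite /s wE linearB /= mulmxBl !mulmxBr ue0 eu0 u1 e1 !mxE eqxx !mulr1n; ring.
  have -> : e *m w^T = (u 0 0 - 1)%:M.
    by rewrite [LHS]mx11_scalar; congr (_%:M); rewrite -rowE wE !mxE !eqxx.
  rewrite mul_scalar_mx scalerA.
  have -> : 2 / s * (u 0 0 - 1) = - 1 by apply: (mulfI s0); rewrite mulrA mulrCA mulrA mulfK // sE; ring.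
  by rewrite scaleN1r opprK wE addrC subrK.
Qed.

(** Induction on the size: a Householder reflection whose first row is a unit eigenvector splits off
    a 1 x 1 block. The first row of the conjugate is then a multiple of [e], and symmetry clears the
    first column as well. *)
Lemma symmetric_spectral (R : rcfType) n (A : 'M[R]_n) : A^T = A ->
  exists (Q : 'M[R]_n) (d : 'rV[R]_n),
    Q *m Q^T = 1%:M /\ Q *m A *m Q^T = diag_mx d.
Proof.
elim: n A => [|n IH] A As.
  by exists 1%:M, 0; split; apply/matrixP => -[].
have [a [u0 [u0N0 u0A]]] := symmetric_eigenvector As.
pose r := Num.sqrt ((u0 *m u0^T) 0 0).
have r2 : r ^+ 2 = (u0 *m u0^T) 0 0.
  by rewrite sqr_sqrtr // mxE sumr_ge0 // => k _; rewrite mxE -expr2 sqr_ge0.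
have r0 : r != 0.
  apply/eqP => r0; case/eqP: u0N0; apply/rowP => j.
  move: r2; rewrite r0 expr0n /= mxE => /esym/eqP; rewrite psumr_eq0 => [|k _]; last by rewrite mxE -expr2 sqr_ge0.
  move=> /allP /(_ j); rewrite mem_index_enum => /(_ isT) /=; rewrite mxE -expr2 sqrf_eq0 => /eqP ->.
  by rewrite mxE.
pose u := r^-1 *: u0.
have u1 : u *m u^T = 1%:M.
  rewrite /u linearZ /= -scalemxAl -scalemxAr scalerA [_ *m _]mx11_scalar -r2.
  rewrite scale_scalar_mx; congr (_%:M); field => //.
have uA : u *m A = a *: u by rewrite /u -scalemxAl u0A scalerA mulrC -scalerA.
have [H [HT HH H0]] := householder u1.
(* Typing [B] at size [1 + n] makes the block operations applicable, and the existential keeps it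
   opaque. *)
have [B BE0] : exists B : 'M[R]_(1 + n), B = H *m A *m H by exists (H *m A *m H).
have BT : B^T = B by rewrite BE0 !trmx_mul HT As mulmxA.
have B0 : row 0 B = a *: delta_mx 0 0.
  rewrite BE0 !row_mul H0 uA -scalemxAl -H0 -row_mul HH; congr (_ *: _).
  by rewrite row1.
have BE : B = block_mx a%:M 0 0 (drsubmx B).
  rewrite -[LHS]submxK.
  have ul : ulsubmx B = a%:M.
    apply/matrixP => i j; rewrite !ord1 mxE mxE (_ : lshift n 0 = 0); last exact/val_inj.
    by have /rowP/(_ 0) := B0; rewrite !mxE => ->; rewrite !eqxx mulr1.
  have ur : ursubmx B = 0.
    apply/matrixP => i j; rewrite !ord1 mxE mxE (_ : lshift n 0 = 0); last exact/val_inj.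
    by have /rowP/(_ (rshift 1 j)) := B0; rewrite !mxE => ->; rewrite mulr0.
  have dl : dlsubmx B = 0 by rewrite -[B]BT -trmx_ursub ur trmx0.
  by rewrite ul ur dl.
have CT : (drsubmx B)^T = drsubmx B by rewrite trmx_drsub BT.
have [Q [dd [QQ QCQ]]] := IH _ CT.
pose Q1 : 'M[R]_(1 + n) := block_mx 1%:M 0 0 Q.
have Q1T : Q1^T = block_mx 1%:M 0 0 Q^T by rewrite /Q1 tr_block_mx trmx1 !trmx0.
pose dg : 'rV[R]_(1 + n) := row_mx (const_mx a) dd.
have QQ1 : Q1 *m Q1^T = 1%:M.
  rewrite Q1T mulmx_block !mul0mx !mulmx0 !mul1mx !addr0 QQ add0r.
  by rewrite -scalar_mx_block.
have QBQ1 : Q1 *m B *m Q1^T = diag_mx dg.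
  rewrite Q1T BE !mulmx_block !(mul0mx, mulmx0, mul1mx, mulmx1, addr0, add0r) QCQ.
  rewrite diag_mx_row; congr block_mx.
  by apply/matrixP => i j; rewrite !ord1 !mxE.
exists (Q1 *m H), dg; rewrite trmx_mul HT; split.
  by rewrite mulmxA -(mulmxA Q1 H H) HH mulmx1 QQ1.
by rewrite -QBQ1 BE0 !mulmxA.
Qed.

Lemma char_poly_orthogonal_conj (R : comNzRingType) n (Q A : 'M[R]_n) :
  Q *m Q^T = 1%:M -> char_poly (Q *m A *m Q^T) = char_poly A.
Proof.
move=> QQ; rewrite /char_poly.
have -> : char_poly_mx (Q *m A *m Q^T) =
    map_mx polyC Q *m char_poly_mx A *m map_mx polyC Q^T.
  rewrite /char_poly_mx mulmxBr mulmxBl -!map_mxM; congr (_ - _).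
  by rewrite scalar_mxC -mulmxA -map_mxM QQ map_mx1 mulmx1.
by rewrite !det_mulmx mulrAC -det_mulmx -map_mxM QQ map_mx1 det1 mul1r.
Qed.

(** * Spectral projectors and spectral distributions in eigencoordinates *)

Section Spectral_projector.
Variables (R : realType) (n : nat).
Implicit Types (A P Q : 'M[R]_n) (x : R).

(** Columns of an idempotent are fixed by it, so idempotents with the same fixed vectors satisfy P1
    P2 = P2 and P2 P1 = P1; transposing one equation gives equality. This identifies the matrix
    selected by [xget]. *)
Lemma is_spec_proj_le_unique A x P1 P2 :
  is_spec_proj_le A x P1 -> is_spec_proj_le A x P2 -> P1 = P2.
Proof.
move=> [T1 [I1 F1]] [T2 [I2 F2]].
have fixcols P P' : (forall u, P *m u = u <-> eig_span_le A x u) ->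
    P' *m P' = P' -> (forall u, P' *m u = u <-> eig_span_le A x u) -> P *m P' = P'.
  move=> F I' F'; apply/matrixP => i j.
  have /F : eig_span_le A x (col j P') by apply/F'; rewrite !colE mulmxA I'.
  by move=> /matrixP/(_ i 0); rewrite colE mulmxA -!colE !mxE.
have E1 := fixcols _ _ F1 I2 F2; have E2 := fixcols _ _ F2 I1 F1.
by rewrite -E2 -[LHS]trmxK trmx_mul T1 T2 E1 T2.
Qed.

Variables (A Q : 'M[R]_n) (d : 'rV[R]_n).
Hypotheses (QQ : Q *m Q^T = 1%:M) (QAQ : Q *m A *m Q^T = diag_mx d).

Let QTQ : Q^T *m Q = 1%:M. Proof. exact: mulmx1C. Qed.

Let QA : Q *m A = diag_mx d *m Q.
Proof. by rewrite -QAQ -mulmxA QTQ mulmx1. Qed.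

Definition ind_row x : 'rV[R]_n := \row_i (d 0 i <= x)%R%:R.

Lemma spec_proj_leE x : spec_proj_le A x = Q^T *m diag_mx (ind_row x) *m Q.
Proof.
suff PP : is_spec_proj_le A x (Q^T *m diag_mx (ind_row x) *m Q).
  apply: (@is_spec_proj_le_unique A x) => //.
  by rewrite /spec_proj_le; apply: (@xgetPex _ 0 [set P | is_spec_proj_le A x P]); exists (Q^T *m diag_mx (ind_row x) *m Q).
have DE (u : 'cV[R]_n) i : (diag_mx (ind_row x) *m u) i 0 = (d 0 i <= x)%R%:R * u i 0.
  by rewrite mul_diag_mx !mxE.
split; first by rewrite !trmx_mul trmxK tr_diag_mx mulmxA.
split.
  rewrite !mulmxA -(mulmxA _ Q) QQ mulmx1 -(mulmxA Q^T) mulmx_diag.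
  by congr (_ *m diag_mx _ *m _); apply/rowP => i; rewrite !mxE -natrM mulnb andbb.
move=> u; split => [Pu|[k [a [w [aw ->]]]]].
  (* [w i] is the component of [u] along the i-th eigenvector, set to zero when its eigenvalue
     exceeds [x]. *)
  pose w (i : 'I_n) := ((ind_row x) 0 i * (Q *m u) i 0) *: (Q^T *m delta_mx i 0) : 'cV[R]_n.
  (* A component set to zero may carry any eigenvalue at most [x]; [x] itself is the default. *)
  exists n, (fun i => if d 0 i <= x then d 0 i else x), w; split.
    move=> i; case: ifPn => dx.
      split=> //; rewrite /w -scalemxAr [RHS]scalerA [d 0 i * _]mulrC -[RHS]scalerA; congr (_ *: _).
      rewrite -[LHS]mul1mx -QTQ -mulmxA (mulmxA A) (mulmxA Q) (mulmxA Q) QAQ scalemxAr; congr (_ *m _).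
      by apply/colP => j; rewrite mul_diag_mx !mxE; case: eqP => [->|_]; rewrite ?mulr0.
    split=> //; rewrite /w /ind_row mxE (negPf dx) mul0r !scale0r mulmx0 scaler0 //.
  rewrite -{1}Pu -!mulmxA.
  under eq_bigr do rewrite /w scalemxAr.
  rewrite -mulmx_sumr; congr (_ *m _); apply/colP => i.
  rewrite DE summxE (bigD1 i) //= big1 => [|j ji].
    by rewrite !mxE !eqxx mulr1 addr0.
  by rewrite !mxE eqxx andbT eq_sym (negPf ji) mulr0.
rewrite mulmx_sumr; apply: eq_bigr => i _; have [ax Aw] := aw i.
have : diag_mx d *m (Q *m w i) = a i *: (Q *m w i).
  by rewrite mulmxA -QA -mulmxA Aw scalemxAr.
move=> /colP Dw.
have -> : Q^T *m diag_mx (ind_row x) *m Q *m w i = Q^T *m (Q *m w i).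
  rewrite -!mulmxA; congr (_ *m _); apply/colP => j; rewrite DE.
  have [dx|dx] := boolP (d 0 j <= x); first by rewrite mul1r.
  (* In eigencoordinates (d_j - a_i) (Q w_i)_j = 0, and a_i <= x < d_j forces the coordinate to
     vanish. *)
  have := Dw j; rewrite mul_diag_mx !mxE => /eqP; rewrite -subr_eq0 -mulrBl mulf_eq0 subr_eq0.
  case/orP => [/eqP da|/eqP ->]; last by rewrite mulr0.
  by rewrite da ax in dx.
by rewrite mulmxA QTQ mul1mx.
Qed.

Lemma PsiE x (v : 'cV[R]_n) : Psi A v x = \sum_(i | d 0 i <= x) (Q *m v) i 0 ^+ 2.
Proof.
rewrite /Psi spec_proj_leE !mulmxA -trmx_mul -!mulmxA mxE [RHS]big_mkcond /=; apply: eq_bigr => i _.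
rewrite mul_diag_mx !mxE; case: ifP => _; last by rewrite mul0r mulr0.
by rewrite mul1r expr2.
Qed.

(** [eigvals] is some list of roots of the split characteristic polynomial. Such lists agree up to
    permutation, so the count may be made on the entries of [d]. *)
Lemma PhiE x : Phi A x = #|[pred i | d 0 i <= x]|%:R / n%:R.
Proof.
congr (_%:R / _); have cpE : char_poly A = \prod_(r <- [seq d 0 i | i : 'I_n]) ('X - r%:P).
  rewrite -(char_poly_orthogonal_conj A QQ) QAQ char_poly_trig ?diag_mx_is_trig //.
  rewrite big_map big_enum /=; apply: eq_bigr => i _.
  by rewrite mxE eqxx mulr1n.
have [_ eE] : [set s : seq R | size s = n /\ char_poly A = \prod_(r <- s) ('X - r%:P)] (eigvals A).
  by apply: xgetPex; exists [seq d 0 i | i : 'I_n]; split; rewrite ?size_image ?card_ord.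
have /permP -> : perm_eq (eigvals A) [seq d 0 i | i : 'I_n].
  by apply: prod_XsubC_eq; rewrite -eE.
rewrite count_map enumT cardE /enum_mem size_filter.
exact: eq_count.
Qed.

End Spectral_projector.

(** * A differential inequality for moment generating functions *)

Section Derivation.
Variable R : realType.
Implicit Types (f g : R -> R) (a b x : R).

Lemma is_derive_funD f g x a b : is_derive x 1 f a -> is_derive x 1 g b ->
  is_derive x 1 (fun y => f y + g y) (a + b).
Proof. by move=> fa gb; exact: is_deriveD. Qed.

Lemma is_derive_funM f g x a b : is_derive x 1 f a -> is_derive x 1 g b ->
  is_derive x 1 (fun y => f y * g y) (a * g x + f x * b).
Proof.
move=> fa gb; apply: (@is_derive_eq _ _ _ (fun y => f y * g y) _ _ _ _ (is_deriveM fa gb)).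
by rewrite addrC [g x *: a]mulrC.
Qed.

Lemma is_derive_funC (c : R) x : is_derive x 1 (fun _ : R => c) 0.
Proof. exact: is_derive_cst. Qed.

Lemma is_derive_funX f x a n : is_derive x 1 f a ->
  is_derive x 1 (fun y => f y ^+ n) (n%:R * f x ^+ n.-1 * a).
Proof. by move=> fa; have := is_deriveX n fa; rewrite exprfctE. Qed.

Lemma is_derive_fun_expR f x a : is_derive x 1 f a ->
  is_derive x 1 (fun y => expR (f y)) (expR (f x) * a).
Proof. by move=> fa; exact: (is_derive1_comp (is_derive_expR (f x)) fa). Qed.

Lemma is_derive_le0 f df : (forall x, is_derive x 1 f (df x)) ->
  (forall x, 0 < x -> df x <= 0) -> forall x, 0 <= x -> f x <= f 0.
Proof.
move=> fdf df0 x; rewrite le_eqVlt => /orP[/eqP <- //|x0].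
have [|c] := @MVT _ f df _ _ x0 (fun y _ => fdf y).
  by apply: derivable_within_continuous => y _; exact: (@ex_derive _ _ _ _ _ _ _ (fdf y)).
rewrite in_itv /= => /andP[c0 cx]; rewrite subr0 => fE.
by rewrite -subr_le0 fE mulr_le0_ge0 ?df0 // ltW.
Qed.

(** [H] is the excess of the logarithmic derivative of [psi] over the derivative of the claimed
    exponent. Two monotonicity arguments follow: one gives H <= 0 on the half-line, the other
    integrates this to the bound on [psi]. *)
Lemma mgf_differential_bound (psi psi1 psi2 : R -> R) (n : nat) (k : R) :
  (0 < n)%N ->
  (forall x, is_derive x 1 psi (psi1 x)) ->
  (forall x, is_derive x 1 psi1 (psi2 x)) ->
  (forall x, 0 < psi x) -> psi 0 = 1 ->
  (forall x, n%:R * psi1 x - k * psi x = 2 * x * (psi1 x - psi2 x)) ->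
  forall x, 0 <= x ->
    psi x <= expR (k / n%:R * x + x ^+ 2 / (4 * (n%:R + 2))).
Proof.
move=> n0 d1 d2 psi0 psi01 ode.
have N0 : 0 < n%:R :> R by rewrite ltr0n.
have N2 : 0 < n%:R + 2 :> R by lra.
(* With this slope, h = k/n + c y solves y h' + (n/2) (h - k/n) = y/4 exactly. *)
pose c : R := (2 * (n%:R + 2))^-1.
pose H y := psi1 y / psi y + - (k / n%:R) + - c * y.
have H_le0 y : 0 <= y -> H y <= 0.
  move=> y0; rewrite -(sqr_sqrtr y0); move: (Num.sqrt y) (sqrtr_ge0 y) => m m0.
  move: m0; rewrite le_eqVlt => /orP[/eqP <-|m0].
    (* At 0 the differential identity reads n psi'(0) = k, so [H] vanishes there. *)
    have := ode 0; rewrite mulr0 mul0r psi01 mulr1 expr0n /= /H psi01 divr1 mulr0 addr0.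
    by move/subr0_eq <-; rewrite mulrAC divff ?gt_eqF // mul1r subrr.
  (* The substitution [y = z ^+ 2] turns the integrating factor y^(n/2) into [z ^+ n]. *)
  pose K z := z ^+ n * H (z ^+ 2).
  pose dH y := (psi2 y * (psi y)^-1 + psi1 y * (- (psi y) ^- 2 * psi1 y)) - c.
  have HdH (z : R) : is_derive z 1 H (dH z).
    apply: (is_derive_eq (is_derive_funD (is_derive_funD (is_derive_funM (d2 z)
      (is_deriveV _ (d1 z))) (is_derive_funC (- (k / n%:R)) z))
      (is_derive_funM (is_derive_funC (- c) z) (is_derive_id z (1 : R))))).
      by rewrite gt_eqF.
    by rewrite /dH addr0 mul0r add0r mulr1.
  have KdK (z : R) : is_derive z 1 K (n%:R * z ^+ n.-1 * H (z ^+ 2) + z ^+ n * (dH (z ^+ 2) * (2 * z))).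
    have sqd := is_derive_funX 2 (is_derive_id z (1 : R)).
    have Hsq : is_derive z 1 (fun y => H (y ^+ 2)) (dH (z ^+ 2) * (2%:R * z ^+ 1 * 1)).
      exact: (@is_derive1_comp _ H (fun y : R => y ^+ 2) z _ _ (HdH _) sqd).
    have := is_derive_funM (is_derive_funX n (is_derive_id z (1 : R))) Hsq.
    by rewrite !mulr1.
  have := @is_derive_le0 K _ KdK _ m (ltW m0).
  rewrite {2}/K expr0n gtn_eqF //= mul0r /K pmulr_rle0 ?exprn_gt0 //; apply => z z0.
  have zE : z ^+ n = z ^+ n.-1 * z by rewrite -exprSr prednK.
  rewrite zE; set l := z ^+ 2.
  (* Eliminating [psi2] by the identity and completing the square in h (1 - h) <= 1/4 leaves the
     derivative of [K] as z^(n-1) times -2 l (h - 1/2)^2. *)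
  rewrite (_ : _ + _ = z ^+ n.-1 * (- 2 * l * (psi1 l / psi l - 2^-1) ^+ 2)).
    rewrite mulr_ge0_le0 ?exprn_ge0 ?(ltW z0) // mulNr mulNr oppr_le0.
    by apply: mulr_ge0 (sqr_ge0 _); apply: mulr_ge0 => //; exact: sqr_ge0.
  have p0 := psi0 l; have := ode l; rewrite /H /dH /c => ol.
  have {ol} -> : psi2 l = psi1 l - (n%:R * psi1 l - k * psi l) / (2 * l).
    by rewrite ol mulrAC divff ?mul1r ?subKr // mulf_neq0 ?pnatr_eq0 // expf_neq0 // gt_eqF.
  move: p0; rewrite /l; move: (psi _) (psi1 _) => p p1 p0.
  by field; rewrite !gt_eqF.
move=> x x0.
(* [L] is [psi] divided by the claimed bound, and its derivative is [L z * H z]. *)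
pose L z := psi z * expR (- (k / n%:R * z + z ^+ 2 / (4 * (n%:R + 2)))).
have LdL (z : R) : is_derive z 1 L (expR (- (k / n%:R * z + z ^+ 2 / (4 * (n%:R + 2)))) * psi z * H z).
  have dlin := is_derive_funM (is_derive_funC (k / n%:R) z) (is_derive_id z (1 : R)).
  have dsq := is_derive_funM (is_derive_funX 2 (is_derive_id z (1 : R)))
    (is_derive_funC (4 * (n%:R + 2))^-1 z).
  apply: (is_derive_eq (is_derive_funM (d1 z) (is_derive_fun_expR
    (is_deriveN (is_derive_funD dlin dsq))))).
  rewrite /H /c /=; have := psi0 z; move: (psi z) (psi1 z) => p p1 p0.
  by field; rewrite !gt_eqF.
have := @is_derive_le0 L _ LdL _ x x0.
rewrite /L psi01 !mulr0 expr0n /= mul0r addr0 oppr0 expR0 mulr1.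
rewrite expRN ler_pdivrMr ?expR_gt0 // mul1r; apply => z z0.
by rewrite mulr_ge0_le0 ?H_le0 ?mulr_ge0 ?expR_ge0 // ltW.
Qed.

End Derivation.

(** * Bounded integrands and differentiation under the integral sign *)

Section Integral_tools.
Context {R : realType} {d : measure_display} {Omega : measurableType d}
  (P : probability Omega R).
Variables (D : set Omega) (mD : measurable D).

Lemma integrable_bounded (f : Omega -> R) (M : R) : measurable_fun D f ->
  (forall w, D w -> `|f w| <= M) -> P.-integrable D (EFin \o f).
Proof.
move=> mf fM; apply: measurable_bounded_integrable => //.
  by rewrite (le_lt_trans (probability_le1 P mD)) ?ltry.
exists M; split; first exact: num_real.
by move=> M' MM' w Dw; apply: (le_trans (fM _ Dw)); exact: ltW.
Qed.

Lemma Rintegral_sum (I : Type) (s : seq I) (p : pred I) (f : I -> Omega -> R) :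
  (forall i, P.-integrable D (EFin \o f i)) ->
  \int[P]_(w in D) (\sum_(i <- s | p i) f i w) = \sum_(i <- s | p i) \int[P]_(w in D) f i w.
Proof.
move=> fi.
have si s' : P.-integrable D (EFin \o (fun w => \sum_(i <- s' | p i) f i w)).
  rewrite (_ : _ \o _ = fun w => (\sum_(i <- s' | p i) (f i w)%:E)%E); last first.
    by apply/funext => w; rewrite /= sumEFin.
  by apply: integrable_sum => // i _; exact: fi.
elim: s => [|i s IH].
  rewrite big_nil; under eq_Rintegral do rewrite big_nil.
  by rewrite /Rintegral integral0.
rewrite big_cons -IH; case: ifP => pi.
  by rewrite -RintegralD //; apply: eq_Rintegral => w _; rewrite big_cons pi.
by apply: eq_Rintegral => w _; rewrite big_cons pi.
Qed.

(** Dominated differentiation on the window of radius 1 about [a]: a constant dominates, being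
    integrable for a probability. *)
Lemma is_derive_Rintegral (f df : R -> Omega -> R) (a M : R) :
  (forall x, measurable_fun D (f x)) ->
  (forall x w, a - 1 < x < a + 1 -> D w -> `|f x w| <= M) ->
  (forall (x : R) w, D w -> is_derive x 1 (f^~ w) (df x w)) ->
  (forall x w, a - 1 < x < a + 1 -> D w -> `|df x w| <= M) ->
  is_derive a 1 (fun x => \int[P]_(w in D) f x w) (\int[P]_(w in D) df a w).
Proof.
move=> mf fM fdf dfM.
have Ia : `]a - 1, a + 1[%classic a by rewrite /= in_itv /=; lra.
have fi x : `]a - 1, a + 1[%classic x -> P.-integrable D (EFin \o f x).
  by rewrite /= in_itv /= => xI; apply: (@integrable_bounded _ M) => // w Dw; exact: fM.
have fder (x : R) w : `]a - 1, a + 1[%classic x -> D w -> derivable (f^~ w) x 1.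
  by move=> _ Dw; exact: (@ex_derive _ _ _ _ _ _ _ (fdf x w Dw)).
have d1E x w : D w -> partial1of2 f x w = df x w.
  by move=> Dw; rewrite partial1of2E (@derive_val _ _ _ _ _ _ _ (fdf x w Dw)).
(* The dominating function must be nonnegative, whence [|M|]: no sign of [M] is given. *)
have Gi : P.-integrable D (EFin \o (fun _ : Omega => `|M|)).
  by apply: (@integrable_bounded _ `|M|) => // w _; rewrite normr_id.
have Gub x w : `]a - 1, a + 1[%classic x -> D w -> `|partial1of2 f x w| <= `|M|.
  rewrite /= in_itv /= => xI Dw; rewrite d1E // (le_trans (dfM _ _ xI Dw)) //.
  exact: ler_norm.
have G0 (w : Omega) : 0 <= `|M| by [].
apply: DeriveDef.
  exact: (derivable_under_integral mD Ia fi fder G0 Gi Gub).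
rewrite -derive1E (differentiation_under_integral mD Ia fi fder G0 Gi Gub).
by apply: eq_Rintegral => w; rewrite inE => Dw; exact: d1E.
Qed.

End Integral_tools.

(** * Random vectors and rotation invariance *)

(* Generators of [cV_borel]: the measurable sets of [borel_cV R n] are, by
   conversion, those of [cV_borel]. *)
Definition coordinate_cylinders (R : realType) (n : nat) : set (set 'cV[R]_n) :=
  [set S | exists (j : 'I_n) (B : set R),
          measurable B /\ S = (fun w : 'cV[R]_n => w j ord0) @^-1` B].

Notation borel_cV R n := (g_sigma_algebraType (@coordinate_cylinders R n)).

Section Random_vectors.
Variables (R : realType) (n : nat).
Local Notation T := (borel_cV R n).

(** The variable X of the argument: if [u] holds the eigencoordinates of a vector and [S] the
    indices of eigenvalues at most x, this is the weighted distribution at x. *)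
Definition sqnorm_on (S : pred 'I_n) (u : 'cV[R]_n) : R :=
  \sum_(i | S i) u i ord0 ^+ 2.

Lemma sqnormE (u : 'cV[R]_n) : (u^T *m u) ord0 ord0 = sqnorm_on predT u.
Proof. by rewrite mxE; apply: eq_bigr => i _; rewrite mxE expr2. Qed.

Lemma sqnorm_on_ge0 S u : 0 <= sqnorm_on S u.
Proof. by apply: sumr_ge0 => i _; exact: sqr_ge0. Qed.

Lemma sqnorm_onC S u : sqnorm_on predT u = sqnorm_on S u + sqnorm_on (predC S) u.
Proof. exact: bigID. Qed.

Lemma measurable_coord j : measurable_fun setT (fun u : T => u j ord0).
Proof.
move=> _ B mB; rewrite setTI; apply: sub_sigma_algebra.
by exists j, B.
Qed.

Section Measurability.
Context {d : measure_display} {Omega : measurableType d}.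
Implicit Type V : Omega -> 'cV[R]_n.

Lemma random_vector_measurable V : random_vector V -> measurable_fun setT (V : Omega -> T).
Proof. by move=> mV _ B mB; rewrite setTI; exact: mV. Qed.

Lemma measurable_sqnorm_on V S : measurable_fun setT (V : Omega -> T) ->
  measurable_fun setT (fun w => sqnorm_on S (V w)).
Proof.
move=> mV; rewrite /sqnorm_on.
under eq_fun do rewrite big_mkcond /=.
apply: measurable_sum => i; case: (S i) => //.
by apply: measurable_funX; exact: (measurableT_comp (measurable_coord i)).
Qed.

Lemma random_vector_mulmx V (Q : 'M[R]_n) : random_vector V ->
  random_vector (fun w => Q *m V w).
Proof.
move=> /random_vector_measurable mV.
suff : measurable_fun setT (fun w => Q *m V w : T).
  by move=> mQ B mB; rewrite -[_ @^-1` _]setTI; exact: mQ.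
apply: (@measurability _ _ Omega T setT _ (@coordinate_cylinders R n)) => // _ [_ [j [B [mB ->]]] <-].
rewrite -[X in measurable X]/(_ `&` (fun w => (Q *m V w) j ord0) @^-1` B).
have : measurable_fun setT (fun w => (Q *m V w) j ord0).
  under eq_fun do rewrite mxE.
  apply: measurable_sum => i; apply: measurable_funM => //.
  exact: (measurableT_comp (measurable_coord i)).
by apply.
Qed.

End Measurability.

Definition sphere : set T := [set u | (u^T *m u) ord0 ord0 = 1].

Lemma measurable_sphere : measurable sphere.
Proof.
have -> : sphere = (sqnorm_on predT : T -> R) @^-1` [set 1].
  by apply/seteqP; split => u; rewrite /sphere /= sqnormE.
rewrite -[X in measurable X]setTI.
by apply: (@measurable_sqnorm_on _ T id predT).
Qed.

Lemma sphere_mulmx (Q : 'M[R]_n) u : Q^T *m Q = 1%:M -> sphere (Q *m u) = sphere u.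
Proof.
by move=> QQ; rewrite /sphere /= trmx_mul mulmxA -(mulmxA _ Q^T) QQ mulmx1.
Qed.

Section Uniform.
Context {d : measure_display} {Omega : measurableType d} (P : probability Omega R).
Variable V : Omega -> 'cV[R]_n.
Hypotheses (mV : random_vector V) (uV : uniform_on_sphere P V).

(** [V] is on the sphere only almost surely; integrating over this event lets bounds valid on the
    sphere apply at every point of the domain. *)
Let on_sphere : set Omega := V @^-1` sphere.

Lemma measurable_on_sphere : measurable on_sphere.
Proof. by apply: mV; exact: measurable_sphere. Qed.

Lemma integrable_on_sphere (g : T -> R) (M : R) : measurable_fun setT g ->
  (forall u, sphere u -> `|g u| <= M) -> P.-integrable on_sphere (EFin \o (g \o V)).
Proof.
move=> mg gM; apply: (integrable_bounded P measurable_on_sphere (M := M)) => [|w]; last exact: gM.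
by apply: measurable_funTS; exact: (measurableT_comp mg (random_vector_measurable mV)).
Qed.

(** Both integrals are integrals of [g] over the sphere, against the laws of [Q *m V] and of [V].
    These laws agree on Borel sets, and the two vectors are on the sphere simultaneously. *)
Lemma Rintegral_rotate (Q : 'M[R]_n) (g : T -> R) (M : R) :
  Q^T *m Q = 1%:M -> measurable_fun setT g -> (forall u, sphere u -> `|g u| <= M) ->
  \int[P]_(w in on_sphere) g (Q *m V w) = \int[P]_(w in on_sphere) g (V w).
Proof.
move=> QQ mg gM; congr fine.
have mV' := random_vector_measurable mV.
have mQV := random_vector_measurable (random_vector_mulmx Q mV).
have mQ : measurable_fun setT (fun u : T => Q *m u : T).
  apply: (@random_vector_measurable _ T).
  by apply: (@random_vector_mulmx _ T id) => B.
have mge : measurable_fun setT (EFin \o g) by exact/measurable_EFinP.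
have DE : on_sphere = (fun w => Q *m V w : T) @^-1` sphere.
  by apply/seteqP; split => w; rewrite /on_sphere /preimage /= sphere_mulmx.
have H1 := integral_pushforward mV' (mu := P) mge (integrable_on_sphere mg gM) measurable_sphere.
have gQM u : sphere u -> `|g (Q *m u)| <= M by move=> su; apply: gM; rewrite sphere_mulmx.
have H2' : P.-integrable ((fun w => Q *m V w : T) @^-1` sphere) ((EFin \o g) \o (fun w => Q *m V w : T)).
  rewrite -DE; apply: (integrable_on_sphere (g := g \o (fun u => Q *m u : T)) (M := M)) => //.
  exact: measurableT_comp.
have H2 := integral_pushforward mQV (mu := P) mge H2' measurable_sphere.
apply: (etrans _ H1); rewrite {1}DE; apply: (etrans (esym H2)).
apply: eq_measure_integral => B mB _ /=; exact: (proj2 uV).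
Qed.

End Uniform.
End Random_vectors.

(** * Moment generating function on the sphere *)

Section Plane_rotation.
Variables (R : realType) (n : nat) (a b : 'I_n).
Hypothesis ab : a != b.

Definition plane_rotation (t : R) : 'M[R]_n :=
  1%:M + (cos t - 1) *: (delta_mx a a + delta_mx b b)
       + sin t *: (delta_mx b a - delta_mx a b).

(** The projection [p] on the plane and the quarter turn [q] multiply like 1 and i: p p = p, p q = q
    p = q, q q = - p. Orthogonality thus reduces to cos^2 + sin^2 = 1. *)
Lemma plane_rotation_orthogonal t : (plane_rotation t)^T *m plane_rotation t = 1%:M.
Proof.
rewrite /plane_rotation.
set p := delta_mx a a + delta_mx b b; set q := delta_mx b a - delta_mx a b.
have ba : (b == a) = false by rewrite eq_sym (negPf ab).
have pT : p^T = p by rewrite /p linearD /= !trmx_delta.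
have qT : q^T = - q by rewrite /q linearB /= !trmx_delta opprB.
have pp : p *m p = p.
  by rewrite /p mulmxDl !mulmxDr !mul_delta_mx_cond !eqxx ba (negPf ab) !mulr0n !mulr1n addr0 add0r.
have pq : p *m q = q.
  by rewrite /p /q mulmxDl !mulmxBr !mul_delta_mx_cond !eqxx ba (negPf ab) !mulr0n !mulr1n sub0r subr0 addrC.
have qp : q *m p = q.
  by rewrite /p /q mulmxBl !mulmxDr !mul_delta_mx_cond !eqxx ba (negPf ab) !mulr0n !mulr1n add0r addr0.
have qq : q *m q = - p.
  rewrite /p /q mulmxBl !mulmxBr !mul_delta_mx_cond !eqxx ba (negPf ab) !mulr0n !mulr1n.
  by rewrite sub0r subr0 opprD addrC.
move: p q pT qT pp pq qp qq => p q pT qT pp pq qp qq.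
rewrite !linearD /= !linearZ /= trmx1 pT qT.
rewrite !(mulmxDl, mulmxDr, mul1mx, mulmx1, mulNmx) -!(scalemxAl, scalemxAr) !(mulNmx, scalerN).
rewrite pp pq qp qq.
have := cos2Dsin2 t; move: (cos t) (sin t) => c s cs.
have {cs} sE : s * s = 1 - c * c by rewrite -cs; ring.
apply/matrixP => i j; rewrite !mxE.
set e := (i == j)%:R; move: (p i j) (q i j) => x y.
transitivity (e + (c * c - 1 + s * s) * x); first by ring.
by rewrite sE; ring.
Qed.

Lemma mul_delta_mx_col (i j k : 'I_n) (u : 'cV[R]_n) :
  (delta_mx i j *m u) k ord0 = (k == i)%:R * u j ord0.
Proof.
rewrite mxE (bigD1 j) //= big1 => [|l lj]; first by rewrite mxE eqxx andbT addr0.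
by rewrite mxE (negPf lj) andbF mul0r.
Qed.

Lemma plane_rotationE t (u : 'cV[R]_n) i : (plane_rotation t *m u) i ord0 =
  if i == a then cos t * u a ord0 - sin t * u b ord0 else
  if i == b then sin t * u a ord0 + cos t * u b ord0 else u i ord0.
Proof.
rewrite /plane_rotation !mulmxDl mul1mx -!scalemxAl mulmxDl mulmxBl.
have := (mul_delta_mx_col a a i u, mul_delta_mx_col b b i u,
  mul_delta_mx_col b a i u, mul_delta_mx_col a b i u).
move: (delta_mx a a *m u) (delta_mx b b *m u) (delta_mx b a *m u) (delta_mx a b *m u).
move=> p1 p2 p3 p4 pE; rewrite !mxE !pE.
have ba : (b == a) = false by rewrite eq_sym (negPf ab).
have [->|ia] := eqVneq i a; first by rewrite (negPf ab) /=; ring.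
by have [->|ib] := eqVneq i b; rewrite /=; ring.
Qed.

(** Of the two coordinates that move, only [a] is counted in [S], so a single summand changes. *)
Lemma sqnorm_on_plane_rotation (S : pred 'I_n) t (u : 'cV[R]_n) : S a -> ~~ S b ->
  sqnorm_on S (plane_rotation t *m u) =
  sqnorm_on S u - u a ord0 ^+ 2 + (cos t * u a ord0 - sin t * u b ord0) ^+ 2.
Proof.
move=> Sa Sb; rewrite /sqnorm_on (bigD1 a) //= [in RHS](bigD1 a) //=.
rewrite plane_rotationE eqxx [X in _ = X - _ + _]addrC addrK [LHS]addrC; congr (_ + _).
apply: eq_bigr => i /andP[Si ia]; rewrite plane_rotationE (negPf ia).
by case: eqP => // ib; rewrite -ib Si in Sb.
Qed.

End Plane_rotation.

(** * Stein identity for the uniform law on the sphere *)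

Section Sphere_mgf.
Context {R : realType} {n : nat} {d : measure_display} {Omega : measurableType d}
  (P : probability Omega R).
Variable V : Omega -> 'cV[R]_n.
Hypotheses (mV : random_vector V) (uV : uniform_on_sphere P V).
Local Notation T := (borel_cV R n).
Local Notation D := (V @^-1` @sphere R n).

Let mD : measurable D. Proof. exact: measurable_on_sphere. Qed.

Let PD : P D = 1%E. Proof. exact: (proj1 uV). Qed.

Lemma sphere_sqnorm (u : 'cV[R]_n) : sphere u -> sqnorm_on predT u = 1.
Proof. by rewrite /sphere /= sqnormE. Qed.

Lemma sphere_sqnorm_on_le1 S (u : 'cV[R]_n) : sphere u -> sqnorm_on S u <= 1.
Proof.
by move/sphere_sqnorm; rewrite (sqnorm_onC S) => <-; rewrite lerDl sqnorm_on_ge0.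
Qed.

Lemma sphere_coord_sqr_le1 i (u : 'cV[R]_n) : sphere u -> u i ord0 ^+ 2 <= 1.
Proof.
by move/(sphere_sqnorm_on_le1 (pred1 i)); rewrite /sqnorm_on big_pred1_eq.
Qed.

Lemma sphere_coord_le1 i (u : 'cV[R]_n) : sphere u -> `|u i ord0| <= 1.
Proof. by move/(sphere_coord_sqr_le1 i); rewrite -real_normK ?num_real // expr_le1. Qed.

Lemma sphere_exp_le S (l : R) (u : 'cV[R]_n) : sphere u ->
  expR (l * sqnorm_on S u) <= expR `|l|.
Proof.
move=> su; rewrite ler_expR (le_trans (ler_norm _)) // normrM ler_piMr //.
by rewrite ger0_norm ?sqnorm_on_ge0 ?sphere_sqnorm_on_le1.
Qed.

Lemma measurable_expR_sqnorm S (l : R) :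
  measurable_fun setT (fun u : T => expR (l * sqnorm_on S u)).
Proof.
apply: measurableT_comp => //; apply: measurable_funM => //.
exact: (@measurable_sqnorm_on _ _ _ T id).
Qed.

Section Stein.
Variables (S : pred 'I_n) (l : R).

(* The derivative at angle 0 of [u a * u b * exp (l * sqnorm_on S u)] along
   the rotation in the plane (a, b). *)
Definition stein_term (a b : 'I_n) (u : 'cV[R]_n) : R :=
  (u a ord0 ^+ 2 - u b ord0 ^+ 2 - 2 * l * u a ord0 ^+ 2 * u b ord0 ^+ 2)
  * expR (l * sqnorm_on S u).

Lemma stein_term_bounded a b u : sphere u ->
  `|stein_term a b u| <= (2 + 2 * `|l|) * expR `|l|.
Proof.
move=> su; rewrite normrM; apply: ler_pM => //; last first.
  by rewrite ger0_norm ?expR_ge0 // sphere_exp_le.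
have ha := sphere_coord_sqr_le1 a su; have hb := sphere_coord_sqr_le1 b su.
have ha0 := sqr_ge0 (u a ord0); have hb0 := sqr_ge0 (u b ord0).
move: (u a ord0 ^+ 2) (u b ord0 ^+ 2) ha hb ha0 hb0 => A B ha hb ha0 hb0.
rewrite (le_trans (ler_normB _ _)) // lerD //.
  by rewrite ler_norml; apply/andP; split; lra.
rewrite -mulrA !normrM (ger0_norm ha0) (ger0_norm hb0) (@ger0_norm _ 2) // -mulrA ler_pM2l //.
by rewrite ler_piMr // mulr_ile1.
Qed.

Lemma measurable_stein_term a b : measurable_fun setT (stein_term a b : T -> R).
Proof.
apply: measurable_funM; last exact: measurable_expR_sqnorm.
have mc i : measurable_fun setT (fun u : T => u i ord0 ^+ 2).
  by apply: measurable_funX; exact: measurable_coord.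
apply: measurable_funB; first exact: measurable_funB.
by apply: measurable_funM => //; apply: measurable_funM.
Qed.

(** By invariance the expectation of [g] at the rotated vector is constant in the angle. Its
    derivative at angle 0, taken under the integral, is the expectation of [stein_term]. *)
Lemma stein_term_expectation a b : S a -> ~~ S b ->
  \int[P]_(w in D) stein_term a b (V w) = 0.
Proof.
move=> Sa Sb; have ab : a != b by apply: contraNneq Sb => <-.
pose g (u : T) := u a ord0 * u b ord0 * expR (l * sqnorm_on S u).
have mg : measurable_fun setT g.
  apply: measurable_funM; last exact: measurable_expR_sqnorm.
  by apply: measurable_funM; exact: measurable_coord.
(* The bound on [g] is relaxed to that of [stein_term], since [is_derive_Rintegral] takes one
   constant for a function and its derivative. *)
have gM u : sphere u -> `|g u| <= (2 + 2 * `|l|) * expR `|l|.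
  move=> su; rewrite normrM; apply: ler_pM => //; last first.
    by rewrite ger0_norm ?expR_ge0 // sphere_exp_le.
  rewrite normrM; have := sphere_coord_le1 a su; have := sphere_coord_le1 b su.
  move=> hb ha; rewrite (@le_trans _ _ 1) ?mulr_ile1 //.
  by have := normr_ge0 l; lra.
have rotP (t : R) := plane_rotation_orthogonal ab t.
have mrot t : measurable_fun setT (fun w => plane_rotation a b t *m V w : T).
  exact/random_vector_measurable/random_vector_mulmx.
pose f t w := g (plane_rotation a b t *m V w).
(* Domination needs the derivative at all angles near 0. At angle [t] it is the same expression at
   the rotated point, which is still on the sphere. *)
pose df t w := stein_term a b (plane_rotation a b t *m V w).
have rot0 (u : 'cV[R]_n) : plane_rotation a b (0 : R) *m u = u.
  by rewrite /plane_rotation cos0 sin0 subrr !scale0r !addr0 mul1mx.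
have fdf (t : R) w : D w -> is_derive t 1 (f^~ w) (df t w).
  move=> _; rewrite /f /df /g; move: (V w) => u.
  set ua := u a ord0; set ub := u b ord0.
  pose ya t := cos t * ua - sin t * ub; pose yb t := sin t * ua + cos t * ub.
  have ra s : (plane_rotation a b s *m u) a ord0 = ya s by rewrite plane_rotationE // eqxx.
  have rb s : (plane_rotation a b s *m u) b ord0 = yb s.
    by rewrite plane_rotationE // eqxx eq_sym (negPf ab).
  have rS s := sqnorm_on_plane_rotation ab s u Sa Sb.
  rewrite (_ : (fun _ => _) = (fun s => ya s * yb s *
    expR (l * (sqnorm_on S u - ua ^+ 2 + ya s ^+ 2)))); last first.
    by apply/funext => s; rewrite ra rb rS.
  have dya : is_derive t 1 ya (- yb t).
    apply: (is_derive_eq (is_derive_funD (is_derive_funM (is_derive_cos t) (is_derive_funC ua t))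
      (is_deriveN (is_derive_funM (is_derive_sin t) (is_derive_funC ub t))))).
    by rewrite /yb /=; ring.
  have dyb : is_derive t 1 yb (ya t).
    apply: (is_derive_eq (is_derive_funD (is_derive_funM (is_derive_sin t) (is_derive_funC ua t))
      (is_derive_funM (is_derive_cos t) (is_derive_funC ub t)))).
    by rewrite /ya /=; ring.
  have dX := is_derive_funM (is_derive_funC l t)
    (is_derive_funD (is_derive_funC (sqnorm_on S u - ua ^+ 2) t) (is_derive_funX 2 dya)).
  apply: (is_derive_eq (is_derive_funM (is_derive_funM dya dyb) (is_derive_fun_expR dX))).
  rewrite /stein_term ra rb rS /= -/(ya t) -/(yb t); ring.
have dE := @is_derive_Rintegral _ _ _ P D mD f df 0 ((2 + 2 * `|l|) * expR `|l|) _ _ fdf _.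
have {dE} : is_derive (0 : R) 1 (fun t => \int[P]_(w in D) f t w) (\int[P]_(w in D) df 0 w).
  apply: dE.
  - by move=> t; apply: measurable_funTS; exact: (measurableT_comp mg (mrot t)).
  - by move=> t w _ Dw; apply: gM; rewrite sphere_mulmx.
  - by move=> t w _ Dw; apply: stein_term_bounded; rewrite sphere_mulmx.
have -> : (fun t => \int[P]_(w in D) f t w) = (fun=> \int[P]_(w in D) g (V w)).
  by apply/funext => t; exact: (Rintegral_rotate mV uV (rotP t) mg gM).
move/(@derive_val _ _ _ _ _ _ _); rewrite derive_cst /df => /esym.
by under eq_Rintegral do rewrite rot0.
Qed.

(** The j-th derivative at [l] of the moment generating function of X; [j = 0] is the function
    itself. *)
Definition moment (j : nat) : R :=
  \int[P]_(w in D) (sqnorm_on S (V w) ^+ j * expR (l * sqnorm_on S (V w))).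

End Stein.

Lemma integrable_moment S (l : R) j : P.-integrable D
  (EFin \o (fun w => sqnorm_on S (V w) ^+ j * expR (l * sqnorm_on S (V w)))).
Proof.
apply: (integrable_on_sphere P mV (g := fun u => sqnorm_on S u ^+ j * expR (l * sqnorm_on S u)) (M := expR `|l|)).
  apply: measurable_funM; last exact: measurable_expR_sqnorm.
  by apply: measurable_funX; exact: (@measurable_sqnorm_on _ _ _ T id).
move=> u su; rewrite ger0_norm ?mulr_ge0 ?exprn_ge0 ?sqnorm_on_ge0 ?expR_ge0 //.
rewrite -[leRHS]mul1r ler_pM ?exprn_ge0 ?sqnorm_on_ge0 ?expR_ge0 ?sphere_exp_le //.
by rewrite exprn_ile1 ?sqnorm_on_ge0 ?sphere_sqnorm_on_le1.
Qed.

(** Sum of the vanishing expectations over a in [S], b outside. On the sphere the squares outside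
    [S] add up to 1 - X, so u_a^2 - u_b^2 sums to (n - k) X - k (1 - X) = n X - k, and u_a^2 u_b^2
    to X (1 - X). *)
Lemma stein_identity S (l : R) :
  n%:R * moment S l 1 - #|S|%:R * moment S l 0 = 2 * l * (moment S l 1 - moment S l 2).
Proof.
apply/eqP; rewrite -subr_eq0; apply/eqP.
have im j := integrable_moment S l j.
have iz j c : P.-integrable D (EFin \o (fun w => c * (sqnorm_on S (V w) ^+ j * expR (l * sqnorm_on S (V w))))).
  rewrite (_ : _ \o _ = fun w => (c%:E * (sqnorm_on S (V w) ^+ j * expR (l * sqnorm_on S (V w)))%:E)%E); last first.
    by apply/funext => w.
  exact: (integrableZl mD c (im j)).
have -> : n%:R * moment S l 1 - #|S|%:R * moment S l 0 - 2 * l * (moment S l 1 - moment S l 2)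
  = (n%:R - 2 * l) * moment S l 1 + (- #|S|%:R) * moment S l 0 + 2 * l * moment S l 2 by ring.
rewrite /moment -!RintegralZl // -(RintegralD mD (iz 1%N _) (iz 0%N _)).
rewrite -(RintegralD mD (integrableD mD (iz 1%N _) (iz 0%N _)) (iz 2%N _)).
transitivity (\int[P]_(w in D) (\sum_(a | S a) \sum_(b | ~~ S b) stein_term S l a b (V w))).
  apply: eq_Rintegral => w; rewrite inE => Dw.
  have := sphere_sqnorm Dw; rewrite (sqnorm_onC S) => XE.
  set e := expR _.
  have -> : \sum_(a | S a) \sum_(b | ~~ S b) stein_term S l a b (V w) =
      (sqnorm_on S (V w) * #|predC S|%:R - #|S|%:R * sqnorm_on (predC S) (V w)
       - 2 * l * (sqnorm_on S (V w) * sqnorm_on (predC S) (V w))) * e.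
    under eq_bigr => a _.
      under eq_bigr => b _ do rewrite /stein_term -/e.
      rewrite -mulr_suml sumrB sumrB sumr_const -mulr_sumr.
      over.
    rewrite -mulr_suml sumrB sumrB -mulr_suml -mulr_sumr sumr_const.
    congr ((_ - _ - _) * _); first by rewrite sumrMnl mulr_natr.
      by rewrite mulr_natl.
    by rewrite mulrA.
  have -> : sqnorm_on (predC S) (V w) = 1 - sqnorm_on S (V w) by rewrite -XE addrC addKr.
  have -> : #|predC S|%:R = n%:R - #|S|%:R :> R.
    by apply/eqP; rewrite eq_sym subr_eq addrC -natrD cardC card_ord.
  by ring.
have ist a b : P.-integrable D (EFin \o (fun w => stein_term S l a b (V w))).
  apply: (integrable_on_sphere P mV (g := stein_term S l a b)); last exact: stein_term_bounded.
  exact: measurable_stein_term.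
rewrite Rintegral_sum // => [|a]; last first.
  rewrite (_ : _ \o _ = fun w => (\sum_(b | ~~ S b) (stein_term S l a b (V w))%:E)%E); last first.
    by apply/funext => w; rewrite /= sumEFin.
  by apply: integrable_sum => // b _; exact: ist.
apply: big1 => a Sa; rewrite Rintegral_sum //.
by apply: big1 => b Sb; exact: stein_term_expectation.
Qed.

Lemma is_derive_moment S j (l : R) :
  is_derive l 1 (fun y => moment S y j) (moment S l j.+1).
Proof.
have bound i (x : R) w : l - 1 < x < l + 1 -> D w ->
    `|sqnorm_on S (V w) ^+ i * expR (x * sqnorm_on S (V w))| <= expR (`|l| + 1).
  move=> xl Dw; rewrite ger0_norm ?mulr_ge0 ?exprn_ge0 ?sqnorm_on_ge0 ?expR_ge0 //.
  rewrite -[leRHS]mul1r ler_pM ?exprn_ge0 ?sqnorm_on_ge0 ?expR_ge0 //.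
    by rewrite exprn_ile1 ?sqnorm_on_ge0 ?sphere_sqnorm_on_le1.
  rewrite (le_trans (sphere_exp_le S x Dw)) // ler_expR.
  rewrite -[x](subrK l) addrC (le_trans (ler_normD _ _)) // lerD2l.
  by rewrite ler_norml; apply/andP; split; lra.
apply: (is_derive_Rintegral P mD (M := expR (`|l| + 1))
  (f := fun x w => sqnorm_on S (V w) ^+ j * expR (x * sqnorm_on S (V w)))
  (df := fun x w => sqnorm_on S (V w) ^+ j.+1 * expR (x * sqnorm_on S (V w)))) => //.
- move=> x; apply: measurable_funTS; apply: measurable_funM.
    by apply: measurable_funX; apply: measurable_sqnorm_on; exact: random_vector_measurable.
  by have /(measurableT_comp (measurable_expR_sqnorm S x)) := random_vector_measurable mV.
- by move=> x w; exact: bound.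
- move=> x w _; set X := sqnorm_on S (V w).
  have dX := is_derive_fun_expR (is_derive_funM (is_derive_id x (1 : R)) (is_derive_funC X x)).
  apply: (is_derive_eq (is_derive_funM (is_derive_funC (X ^+ j) x) dX)).
  by rewrite /= exprS; ring.
- by move=> x w; exact: bound.
Qed.

Lemma Rintegral_sphere_cst (c : R) : \int[P]_(_ in D) c = c.
Proof.
rewrite Rintegral_cst // -[RHS]mulr1; congr (_ * _); exact: (congr1 fine PD).
Qed.

(** On the sphere the integrand is at least exp(-|l|), and the event has probability one. *)
Lemma moment0_gt0 S (l : R) : 0 < moment S l 0.
Proof.
have cint : P.-integrable D (EFin \o (fun _ => expR (- `|l|))).
  by apply: (integrable_bounded P mD (M := `|expR (- `|l|)|)).
have := le_Rintegral mD cint (integrable_moment S l 0).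
rewrite Rintegral_sphere_cst => le; apply: (lt_le_trans (expR_gt0 (- `|l|))).
apply: le => w Dw; rewrite mul1r ler_expR lerNl.
rewrite (le_trans (ler_norm _)) // normrN normrM ler_piMr //.
by rewrite ger0_norm ?sqnorm_on_ge0 ?sphere_sqnorm_on_le1.
Qed.

Lemma moment00 S : moment S 0 0 = 1.
Proof.
rewrite /moment; under eq_Rintegral do rewrite mul0r expR0 mulr1 expr0.
exact: Rintegral_sphere_cst.
Qed.

Lemma sphere_mgf_pos S (l : R) : (0 < n)%N -> 0 <= l ->
  moment S l 0 <= expR (#|S|%:R / n%:R * l + l ^+ 2 / (4 * (n%:R + 2))).
Proof.
move=> n0 l0; apply: (mgf_differential_bound (psi := fun y => moment S y 0)
  (psi1 := fun y => moment S y 1) (psi2 := fun y => moment S y 2)) => //.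
- exact: is_derive_moment.
- exact: is_derive_moment.
- exact: moment0_gt0.
- exact: moment00.
- exact: stein_identity.
Qed.

Lemma sphere_mgf S (l : R) : (0 < n)%N ->
  \int[P]_(w in D) expR (l * (sqnorm_on S (V w) - #|S|%:R / n%:R)) <=
  expR (l ^+ 2 / (4 * (n%:R + 2))).
Proof.
move=> n0; have N0 : n%:R != 0 :> R by rewrite pnatr_eq0 -lt0n.
have key S' (l' : R) : 0 <= l' ->
    \int[P]_(w in D) expR (l' * (sqnorm_on S' (V w) - #|S'|%:R / n%:R)) <=
    expR (l' ^+ 2 / (4 * (n%:R + 2))).
  move=> l0; have := sphere_mgf_pos S' n0 l0.
  rewrite addrC expRD -ler_pdivrMr ?expR_gt0 // -expRN; apply: le_trans.
  rewrite [leRHS]mulrC /moment -RintegralZl //; last exact: integrable_moment.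
  rewrite le_eqVlt; apply/orP; left; apply/eqP; apply: eq_Rintegral => w _.
  by rewrite expr0 mul1r -expRD; congr expR; ring.
have [l0|l0] := leP 0 l; first exact: key.
(* On the sphere, passing to the complement of [S] changes the sign of X - k/n, which turns a
   negative [l] into a positive one. *)
have := key (predC S) (- l); rewrite sqrrN oppr_ge0 => /(_ (ltW l0)).
apply: le_trans; rewrite le_eqVlt; apply/orP; left; apply/eqP.
apply: eq_Rintegral => w; rewrite inE => Dw; congr expR.
have := sphere_sqnorm Dw; rewrite (sqnorm_onC S) => XE.
have -> : sqnorm_on S (V w) = 1 - sqnorm_on (predC S) (V w) by rewrite -XE addrK.
have -> : #|predC S|%:R = n%:R - #|S|%:R :> R.
  by apply/eqP; rewrite eq_sym subr_eq addrC -natrD cardC card_ord.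
by field.
Qed.

End Sphere_mgf.

(** * Products of independent variables *)

Section Independent_integral.
Import HBNNSimple.
Context {R : realType} {d d' : measure_display} {Omega : measurableType d}
  {T : measurableType d'} (P : probability Omega R).
Local Open Scope ereal_scope.

(** [G] stands for the product of the remaining factors and [C] for its expectation. Factorization
    for indicators extends to simple functions by summing over level sets. *)
Lemma integral_weight_nnsfun (W : Omega -> T) (G : Omega -> R) (C : \bar R) :
  measurable_fun setT W -> measurable_fun setT G -> (forall w, (0 <= G w)%R) -> 0 <= C ->
  (forall B, measurable B -> \int[P]_w (\1_B (W w) * G w)%:E = C * P (W @^-1` B)) ->
  forall h : {nnsfun T >-> R}, \int[P]_w (h (W w) * G w)%:E =
    C * \sum_(y \in range h) y%:E * P (W @^-1` (h @^-1` [set y])).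
Proof.
move=> mW mG G0 C0 HB h.
have mi y : measurable_fun setT (fun w => (\1_(h @^-1` [set y]) (W w) * G w)%R).
  apply: measurable_funM => //.
  by apply: (measurableT_comp _ mW); exact: measurable_indic.
have hE w : (h (W w) * G w)%:E =
    \sum_(y \in range h) (y * (\1_(h @^-1` [set y]) (W w) * G w))%:E.
  rewrite fsumEFin // {1}fimfunE; congr EFin.
  rewrite !fsbig_finite //= mulr_suml; apply: eq_bigr => y _.
  by rewrite mulrA.
under eq_integral do rewrite hE.
have ypos y w : (0 <= y * (\1_(h @^-1` [set y]) (W w) * G w))%R.
  have [hy|hy] := eqVneq (h (W w)) y.
    by rewrite -hy !mulr_ge0.
  by rewrite indicE memNset ?mul0r ?mulr0 // /preimage /=; apply/eqP.
rewrite ge0_integral_fsum //; last 2 first.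
- by move=> y; apply/measurable_EFinP; exact: measurable_funM.
- by move=> y w _; rewrite lee_fin.
rewrite ge0_mule_fsumr; last first.
  move=> y; have [y0|y0] := leP 0%R y; first by rewrite mule_ge0 ?lee_fin.
  (* A negative [y] is not a value of [h], so its level set is empty. *)
  by rewrite preimage_nnfun0 // preimage_set0 measure0 mule0.
apply: eq_fsbigr => y; rewrite inE => -[z _ <-].
under eq_integral do rewrite EFinM.
rewrite ge0_integralZl_EFin //; last 2 first.
- by move=> w _; rewrite lee_fin mulr_ge0.
- by apply/measurable_EFinP.
by rewrite HB // muleCA.
Qed.

(** Monotone convergence along simple approximations of [h], applied to both sides; finiteness of
    [C] lets the multiplication by [C] pass to the limit. *)
Lemma integral_weight (W : Omega -> T) (G : Omega -> R) (C : \bar R) :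
  measurable_fun setT W -> measurable_fun setT G -> (forall w, (0 <= G w)%R) ->
  0 <= C -> C \is a fin_num ->
  (forall B, measurable B -> \int[P]_w (\1_B (W w) * G w)%:E = C * P (W @^-1` B)) ->
  forall h : T -> R, measurable_fun setT h -> (forall x, (0 <= h x)%R) ->
    \int[P]_w (h (W w) * G w)%:E = C * \int[P]_w (h (W w))%:E.
Proof.
move=> mW mG G0 C0 Cfin HB h mh h0.
have meh : measurable_fun setT (EFin \o h) by exact/measurable_EFinP.
pose hk := nnsfun_approx measurableT meh.
have heh0 : forall x : T, setT x -> 0 <= (EFin \o h) x by move=> x _; rewrite lee_fin.
have hkh x : (hk k x)%:E @[k --> \oo] --> (h x)%:E.
  exact: (cvg_nnsfun_approx measurableT meh heh0).
have nd x : {homo (fun k => hk k x) : k l / (k <= l)%N >-> (k <= l)%R}.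
  by move=> k l kl; have /lefP := nd_nnsfun_approx measurableT meh kl.
have conv (G' : Omega -> R) : measurable_fun setT G' -> (forall w, (0 <= G' w)%R) ->
    \int[P]_w (hk k (W w) * G' w)%:E @[k --> \oo] --> \int[P]_w (h (W w) * G' w)%:E.
  move=> mG' G'0.
  have := @cvg_monotone_convergence _ _ _ P setT measurableT
    (fun k w => (hk k (W w) * G' w)%:E).
  have limE w : limn (fun k => (hk k (W w) * G' w)%:E) = (h (W w) * G' w)%:E.
    apply/cvg_lim => //.
    under eq_fun do rewrite EFinM.
    by rewrite EFinM; apply: cvgeZr.
  under [X in _ -> _ -> _ -> _ --> X]eq_integral do rewrite limE.
  apply.
  - move=> k; apply/measurable_EFinP/measurable_funM => //.
    exact: measurableT_comp.
  - by move=> k w _; rewrite lee_fin mulr_ge0.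
  - by move=> w _ k l kl; rewrite lee_fin ler_wpM2r // nd.
have c1 := conv G mG G0.
have c2 := @cvgeZl _ _ _ _ _ _ Cfin (conv (cst 1%R) (measurable_cst _) (fun=> ler01)).
have -> : \int[P]_w (h (W w))%:E = \int[P]_w (h (W w) * cst 1%R w)%:E.
  by apply: eq_integral => w _; rewrite mulr1.
suff E : (fun k => \int[P]_w (hk k (W w) * G w)%:E) =
    (fun k => C * \int[P]_w (hk k (W w) * cst 1%R w)%:E).
  by rewrite -(cvg_lim _ c1) // -(cvg_lim _ c2) // E.
apply/funext => k; rewrite (integral_weight_nnsfun mW mG G0 C0 HB).
(* The right-hand side is the same sum over level sets, read with weight 1 and constant 1. *)
rewrite (@integral_weight_nnsfun W (cst 1%R) 1) ?mul1e // => B mB.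
rewrite mul1e; under eq_integral do rewrite mulr1.
rewrite -[W @^-1` B]setIT -integral_indic //.
by rewrite -[_ @^-1` _]setTI; exact: mW.
Qed.

(** Independence is the case of indicators. The factors are then made arbitrary one at a time, the
    finite expectations keeping the constant of [integral_weight] finite. *)
Lemma integral_prod_independent (m : nat) (V : 'I_m -> Omega -> T) :
  (forall i, measurable_fun setT (V i)) ->
  (forall B : 'I_m -> set T, (forall i, measurable (B i)) ->
    P (\bigcap_(i in [set: 'I_m]) (V i @^-1` B i)) = \prod_(i < m) P (V i @^-1` B i)) ->
  forall g : 'I_m -> T -> R,
  (forall i, measurable_fun setT (g i)) -> (forall i x, (0 <= g i x)%R) ->
  (forall i, \int[P]_w (g i (V i w))%:E < +oo) ->
  \int[P]_w (\prod_(i < m) g i (V i w))%:E = \prod_(i < m) \int[P]_w (g i (V i w))%:E.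
Proof.
move=> mV ind.
have mpre i B : measurable B -> measurable (V i @^-1` B).
  by move=> mB; rewrite -[_ @^-1` _]setTI; exact: mV.
have int_ind i B : measurable B -> \int[P]_w (\1_B (V i w))%:E = P (V i @^-1` B).
  move=> mB; have := @integral_indic _ _ _ P _ measurableT _ (mpre i B mB).
  by rewrite setIT.
(* Induction on [s]: factors of index below [s] are arbitrary, the others are indicators. *)
suff H s : forall g : 'I_m -> T -> R,
    (forall i : 'I_m, (s <= i)%N -> exists2 B, measurable B & g i = \1_B) ->
    (forall i, measurable_fun setT (g i)) -> (forall i x, (0 <= g i x)%R) ->
    (forall i, \int[P]_w (g i (V i w))%:E < +oo) ->
    \int[P]_w (\prod_(i < m) g i (V i w))%:E = \prod_(i < m) \int[P]_w (g i (V i w))%:E.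
  by move=> g; apply: (H m) => i; rewrite leqNgt ltn_ord.
elim: s => [|s IH] g gind mg g0 gfin.
  have /choice[B HB] : forall i, exists B, measurable B /\ g i = \1_B.
    by move=> i; have [B mB ->] := gind i (leq0n i); exists B.
  have -> : \int[P]_w (\prod_(i < m) g i (V i w))%:E =
      P (\bigcap_(i in [set: 'I_m]) (V i @^-1` B i)).
    rewrite -[X in P X]setIT -integral_indic //; last first.
      by apply: fin_bigcap_measurable => // i _; apply: mpre; case: (HB i).
    apply: eq_integral => w _; congr EFin.
    rewrite indicE; case: (boolP (w \in _)) => [|].
      rewrite inE => wB; rewrite big1 // => i _.
      by rewrite (HB i).2 indicE mem_set //; exact: wB.
    rewrite notin_setE => nB; have [i nBi] : exists i, ~ B i (V i w).
      by apply: contrapT => h; apply: nB => i _; apply: contrapT => h'; apply: h; exists i.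
    rewrite (bigD1 i) //= (HB i).2 indicE memNset ?mul0r //.
  rewrite ind; last by move=> i; case: (HB i).
  by apply: eq_bigr => i _; rewrite (HB i).2 int_ind //; case: (HB i).
have [ms|sm] := leqP m s.
  by apply: IH => // i si; have := leq_trans (ltn_ord i) ms; rewrite ltnNge si.
pose i0 := Ordinal sm.
pose C := \prod_(i < m | i != i0) \int[P]_w (g i (V i w))%:E.
pose G w := (\prod_(i < m | i != i0) g i (V i w))%R.
have intg0 i : 0 <= \int[P]_w (g i (V i w))%:E.
  by apply: integral_ge0 => w _; rewrite lee_fin.
have intfin i : \int[P]_w (g i (V i w))%:E \is a fin_num by rewrite ge0_fin_numE.
have C0 : 0 <= C by apply: (big_ind (fun x => 0 <= x)) => // x y; exact: mule_ge0.
have Cfin : C \is a fin_num.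
  by apply: (big_ind (fun x => x \is a fin_num)) => // x y; exact: fin_numM.
have mG : measurable_fun setT G.
  rewrite /G; under eq_fun do rewrite big_mkcond /=.
  apply: measurable_prod => i _; case: (i != i0) => //.
  exact: measurableT_comp.
have G0 w : (0 <= G w)%R by apply: prodr_ge0.
rewrite (bigD1 i0) //= muleC -/C.
rewrite -(integral_weight (mV i0) mG G0 C0 Cfin _ (mg i0) (g0 i0)).
  by apply: eq_integral => w _; rewrite (bigD1 i0).
(* With an indicator put in place of factor [s], the induction hypothesis is exactly the
   factorization on indicators required to free that factor. *)
move=> B mB; pose g' i := if i == i0 then \1_B else g i.
have g'E i : i != i0 -> g' i = g i by rewrite /g' => /negPf ->.
have g'i0 : g' i0 = \1_B by rewrite /g' eqxx.
have := IH g'; rewrite (bigD1 i0) //= g'i0 int_ind // muleC.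
have -> : \prod_(i < m | i != i0) \int[P]_w (g' i (V i w))%:E = C.
  by apply: eq_bigr => i ii0; rewrite g'E.
have -> : \int[P]_w (\prod_(i < m) g' i (V i w))%:E = \int[P]_w (\1_B (V i0 w) * G w)%:E.
  apply: eq_integral => w _; rewrite (bigD1 i0) //= g'i0; congr (_ * _)%:E.
  by apply: eq_bigr => i ii0; rewrite g'E.
apply.
- move=> i si; have [ii0|ii0] := eqVneq i i0; first by exists B => //; rewrite ii0.
  rewrite g'E //; apply: gind; rewrite ltn_neqAle si andbT.
  by apply: contra ii0 => /eqP si'; apply/eqP/val_inj.
- by move=> i; rewrite /g'; case: ifP.
- by move=> i x; rewrite /g'; case: ifP.
- move=> i; rewrite /g'; case: ifPn => // _.
  by rewrite int_ind // (le_lt_trans (probability_le1 _ _)) ?ltry //; exact: mpre.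
Qed.

End Independent_integral.

(** * Tail bounds *)

Section Tail.
Context {R : realType} {n : nat} {d : measure_display} {Omega : measurableType d}
  (P : probability Omega R).
Local Notation T := (borel_cV R n).

(** Invariance of [Q *m V] under [Q'] is invariance of [V] under [Q' *m Q] compared with that under
    [Q]. This allows working in eigencoordinates. *)
Lemma uniform_on_sphere_mulmx (V : Omega -> 'cV[R]_n) (Q : 'M[R]_n) :
  random_vector V -> Q^T *m Q = 1%:M ->
  uniform_on_sphere P V -> uniform_on_sphere P (fun w => Q *m V w).
Proof.
move=> mV QQ [V1 Vinv]; split.
  rewrite -[RHS]V1; congr (P _); apply/seteqP; split => w /=;
  by rewrite trmx_mul mulmxA -(mulmxA _ Q^T) QQ mulmx1.
move=> Q' QQ' B mB; rewrite (Vinv Q QQ B mB).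
under eq_fun do rewrite mulmxA.
by apply: Vinv => //; rewrite trmx_mul mulmxA -(mulmxA _ Q'^T) QQ' mulmx1.
Qed.

(** The complement of the sphere event is negligible, so the bound on the restricted integral holds
    over the whole space. *)
Lemma sphere_expectation_mgf (V : Omega -> 'cV[R]_n) (S : pred 'I_n) (l : R) :
  (0 < n)%N -> random_vector V -> uniform_on_sphere P V ->
  (\int[P]_w (expR (l * (sqnorm_on S (V w) - #|S|%:R / n%:R)))%:E
    <= (expR (l ^+ 2 / (4 * (n%:R + 2))))%:E)%E.
Proof.
move=> n0 mV uV; pose D := V @^-1` @sphere R n.
have mD : measurable D := measurable_on_sphere mV.
have PC : P (~` D) = 0%E by rewrite probability_setC // (proj1 uV) subee.
have mX := measurable_sqnorm_on S (random_vector_measurable mV).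
have mf : measurable_fun setT (fun w => (expR (l * (sqnorm_on S (V w) - #|S|%:R / n%:R)))%:E).
  apply/measurable_EFinP; apply: measurableT_comp => //.
  by apply: measurable_funM => //; exact: measurable_funB.
rewrite (ge0_negligible_integral (measurableC mD) _ mf) //.
rewrite setDE setCK setTI -/D.
have ig : P.-integrable D (EFin \o (fun w => expR (l * (sqnorm_on S (V w) - #|S|%:R / n%:R)))).
  apply: (integrable_bounded P mD (M := expR (- (l * (#|S|%:R / n%:R))) * expR `|l|)).
    by apply: measurable_funTS; exact/measurable_EFinP.
  move=> w Dw; rewrite ger0_norm ?expR_ge0 // mulrBr expRD mulrC.
  by rewrite ler_wpM2l ?expR_ge0 // sphere_exp_le.
have := sphere_mgf mV uV S l n0; rewrite /Rintegral -lee_fin fineK //.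
exact: integrable_fin_num ig.
Qed.

Variables (nv : nat) (v : 'I_nv -> Omega -> 'cV[R]_n).
Hypotheses (n0 : (0 < n)%N) (mv : forall i, random_vector (v i))
  (uv : forall i, uniform_on_sphere P (v i)) (iv : mutually_independent P v).
Variables (Q : 'M[R]_n) (S : pred 'I_n).
Hypothesis QQ : Q^T *m Q = 1%:M.

Let dev w := \sum_(i < nv) (sqnorm_on S (Q *m v i w) - #|S|%:R / n%:R).

Lemma measurable_deviation : measurable_fun setT dev.
Proof.
apply: measurable_sum => i; apply: measurable_funB => //.
exact/measurable_sqnorm_on/random_vector_measurable/random_vector_mulmx.
Qed.

Lemma deviation_tail (sg t : R) : sg ^+ 2 = 1 -> 0 < t ->
  (P [set w | (nv%:R * t < sg * dev w)%R] <=
   (expR (- (nv%:R * (n%:R + 2) * t ^+ 2)))%:E)%E.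
Proof.
(* [r] minimizes the Chernoff exponent r^2 / (4 (n+2)) - r t, with minimum - (n+2) t^2; [sg] selects
   the upper or the lower tail. *)
move=> sg1 t0; pose r := 2 * (n%:R + 2) * t.
have N2 : 0 < n%:R + 2 :> R by have : 0 <= n%:R :> R by []; lra.
have r0 : 0 < r by rewrite !mulr_gt0.
pose A := [set w | (nv%:R * t < sg * dev w)%R].
have mA : measurable A.
  rewrite -[A]setTI; apply: (measurable_fun_ltr (measurable_cst _)) => //.
  by apply: measurable_funM => //; exact: measurable_deviation.
(* Each factor carries its own share [t] of the threshold, so the product is exp(r (sg dev - nv t)),
   which is at least 1 on [A]. *)
pose g (i : 'I_nv) (u : T) := expR (r * (sg * (sqnorm_on S (Q *m u) - #|S|%:R / n%:R) - t)).
have mg i : measurable_fun setT (g i).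
  apply: measurableT_comp => //; apply: measurable_funM => //.
  apply: measurable_funB => //; apply: measurable_funM => //; apply: measurable_funB => //.
  apply: (@measurable_sqnorm_on _ _ _ T (fun u : T => Q *m u)).
  apply: random_vector_measurable; apply: (@random_vector_mulmx _ _ _ T id) => B //.
have g0 i u : 0 <= g i u by exact: expR_ge0.
have gint i : (\int[P]_w (g i (v i w))%:E <= (expR (- ((n%:R + 2) * t ^+ 2)))%:E)%E.
  have := sphere_expectation_mgf S (r * sg) n0 (random_vector_mulmx Q (mv i))
    (uniform_on_sphere_mulmx (mv i) QQ (uv i)).
  have mf : measurable_fun setT (fun w =>
      (expR (r * sg * (sqnorm_on S (Q *m v i w) - #|S|%:R / n%:R)))%:E).
    apply/measurable_EFinP; apply: measurableT_comp => //; apply: measurable_funM => //.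
    apply: measurable_funB => //.
    exact/measurable_sqnorm_on/random_vector_measurable/random_vector_mulmx.
  have -> : (\int[P]_w (g i (v i w))%:E = (expR (- (r * t)))%:E *
      \int[P]_w (expR (r * sg * (sqnorm_on S (Q *m v i w) - #|S|%:R / n%:R)))%:E)%E.
    rewrite -ge0_integralZl_EFin ?expR_ge0 //.
    apply: eq_integral => w _; rewrite -EFinM -expRD /g; congr (expR _)%:E; ring.
  move=> le; apply: (le_trans (lee_wpmul2l _ le)); first by rewrite lee_fin expR_ge0.
  rewrite -EFinM -expRD lee_fin ler_expR exprMn sg1 mulr1 le_eqVlt; apply/orP; left; apply/eqP.
  by rewrite /r; field; rewrite gt_eqF.
have := integral_prod_independent (fun i => random_vector_measurable (mv i)) iv mg g0.
move=> /(_ (fun i => le_lt_trans (gint i) (ltry _))) prodE.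
have -> : P [set w | (nv%:R * t < sg * dev w)%R] = (\int[P]_w (\1_A w)%:E)%E.
  by rewrite integral_indic // setIT.
apply: (@le_trans _ _ (\int[P]_w (\prod_(i < nv) g i (v i w))%:E)%E).
  apply: ge0_le_integral => //.
  - by apply/measurable_EFinP; exact: measurable_indic.
  - apply/measurable_EFinP; apply: measurable_prod => i _.
    exact: (measurableT_comp (mg i) (random_vector_measurable (mv i))).
  - move=> w _; rewrite lee_fin /g -expR_sum indicE.
    case: (boolP (w \in A)) => [|_]; last by rewrite expR_ge0.
    rewrite inE => Aw; rewrite -[leLHS]expR0 ler_expR -mulr_sumr mulr_ge0 ?(ltW r0) //.
    rewrite sumrB -mulr_sumr sumr_const card_ord -[t *+ nv]mulr_natl subr_ge0.
    exact: ltW.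
rewrite prodE.
have -> : (expR (- (nv%:R * (n%:R + 2) * t ^+ 2)))%:E =
    (\prod_(i < nv) (expR (- ((n%:R + 2) * t ^+ 2)))%:E)%E.
  by rewrite prodEFin prodr_const card_ord -expRM_natl; congr (expR _)%:E; ring.
(* Products of extended reals are monotone for nonnegative factors, so the sign is carried along
   with the inequality. *)
suff [] : (0 <= \prod_(i < nv) \int[P]_w (g i (v i w))%:E /\
    \prod_(i < nv) \int[P]_w (g i (v i w))%:E <=
    \prod_(i < nv) (expR (- ((n%:R + 2) * t ^+ 2)))%:E)%E by [].
apply: (big_ind2 (fun x y : \bar R => 0 <= x /\ x <= y)%E) => //.
  by move=> x1 x2 y1 y2 [x10 x12] [y10 y12]; split; [exact: mule_ge0|exact: lee_pmul].
by move=> i _; split => //; apply: integral_ge0 => w _; rewrite lee_fin.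
Qed.

End Tail.

(** * Kolmogorov-Smirnov distance of step functions *)

Section Step_functions.
Variables (R : realType) (n : nat) (d : 'rV[R]_n) (F G : R -> R).
Hypothesis FG_step : forall x y,
  (forall i, (d 0 i <= x) = (d 0 i <= y)) -> `|F x - G x| = `|F y - G y|.
Hypothesis FG_left : forall x, (forall i, x < d 0 i) -> `|F x - G x| = 0.

(** [x] compares with all jump points exactly as the largest jump point at most [x] does, if there
    is one; otherwise [x] is left of all of them. *)
Lemma step_distance x :
  `|F x - G x| = 0 \/ exists j, `|F x - G x| = `|F (d 0 j) - G (d 0 j)|.
Proof.
have [/existsP[j0 j0x]|/existsPn none] := boolP [exists i, d 0 i <= x].
  right; have [j jx jmax] := @arg_maxP _ _ _ j0 (fun i => d 0 i <= x) (fun i => d 0 i) j0x.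
  exists j; apply: FG_step => i; apply/idP/idP => [/jmax //|ij].
  exact: le_trans ij jx.
by left; apply: FG_left => i; rewrite ltNge none.
Qed.

(** The distance takes only its values at the jump points and possibly 0, and t > 0 excludes 0. The
    event on the supremum thus becomes a finite union. *)
Lemma lt_dKS_step (t : R) : 0 < t ->
  (t < dKS F G) <-> exists j, t < `|F (d 0 j) - G (d 0 j)|.
Proof.
move=> t0; rewrite /dKS; split => [tA|[j tj]].
  have [|_ [x _ <-] tx] := sup_gt _ tA; first by exists `|F 0 - G 0|, 0.
  have [x0|[j xj]] := step_distance x; first by move: tx; rewrite x0 ltNge (ltW t0).
  by exists j; rewrite -xj.
apply: (lt_le_trans tj); apply: ub_le_sup; last by exists (d 0 j).
(* A crude bound, which only serves to make the supremum dominate the range. *)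
exists (\sum_i `|F (d 0 i) - G (d 0 i)|) => _ [x _ <-].
have [->|[i ->]] := step_distance x; first exact: sumr_ge0.
by rewrite (bigD1 i) //= lerDl sumr_ge0.
Qed.

End Step_functions.

Lemma measure_bigsetU_le (R : realType) (d : measure_display) (T : measurableType d)
    (mu : {measure set T -> \bar R}) (I : Type) (s : seq I) (E : I -> set T) :
  (forall i, measurable (E i)) ->
  (mu (\big[setU/set0]_(i <- s) E i) <= \sum_(i <- s) mu (E i))%E.
Proof.
move=> mE; elim: s => [|i s IH]; first by rewrite !big_nil measure0.
rewrite !big_cons (le_trans (measureU2 _ _ _)) //; first exact: bigsetU_measurable.
exact: leeD2l.
Qed.

(** * Union bounds over the two tails and over the eigenvalues *)

Theorem theorem2 (R : realType) (n nv : nat) (A : 'M[R]_n)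
    (d : measure_display) (Omega : measurableType d) (P : probability Omega R)
    (v : 'I_nv -> Omega -> 'cV[R]_n) :
  A^T = A -> (0 < nv)%N ->
  (forall i, random_vector (v i)) ->
  (forall i, uniform_on_sphere P (v i)) ->
  mutually_independent P v ->
  forall t : R, 0 < t ->
    (forall x : R,
      (P [set w | (t < `|Phi A x - nv%:R^-1 * \sum_(i < nv) Psi A (v i w) x|)%R]
        <= (2 * expR (- (nv%:R * (n%:R + 2) * t ^+ 2)))%:E)%E) /\
    (P [set w | (t < dKS (Phi A) (fun y => nv%:R^-1 * \sum_(i < nv) Psi A (v i w) y))%R]
        <= (2 * n%:R * expR (- (nv%:R * (n%:R + 2) * t ^+ 2)))%:E)%E.
Proof.
move=> As nv0 mv uv iv t t0.
(* In dimension 0 the sphere is empty, which contradicts almost sure membership of the first vector;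
   [nv0] provides its index. *)
have n0 : (0 < n)%N.
  case: n A v As mv uv iv => // A v As mv uv iv.
  have [] := uv (Ordinal nv0); rewrite (_ : [set w | _] = set0).
    by rewrite measure0 => /eqP; rewrite eqe eq_sym oner_eq0.
  by apply/seteqP; split => // w /= /eqP; rewrite mxE big_ord0 eq_sym oner_eq0.
have [Q [dg [QQ QAQ]]] := symmetric_spectral As.
have QTQ : Q^T *m Q = 1%:M by exact: mulmx1C.
have N0 : 0 < nv%:R :> R by rewrite ltr0n.
pose E x := [set w | t < `|Phi A x - nv%:R^-1 * \sum_(i < nv) Psi A (v i w) x|].
pose S x : pred 'I_n := [pred i | dg 0 i <= x].
pose dev x w := \sum_(i < nv) (sqnorm_on (S x) (Q *m v i w) - #|S x|%:R / n%:R).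
(* In eigencoordinates the error is minus the average of centred copies of X, the mean k/n being the
   unweighted distribution at x. *)
have diffE x w : Phi A x - nv%:R^-1 * \sum_(i < nv) Psi A (v i w) x = - (nv%:R^-1 * dev x w).
  have PsiS i : Psi A (v i w) x = sqnorm_on (S x) (Q *m v i w) by exact: PsiE.
  rewrite (_ : Phi A x = #|S x|%:R / n%:R); last exact: (PhiE QQ QAQ).
  rewrite /dev sumrB sumr_const card_ord -[_ / _ *+ nv]mulr_natl.
  under eq_bigr do rewrite PsiS.
  by field; rewrite !pnatr_eq0 -!lt0n nv0 n0.
pose Es x (sg : R) := [set w | nv%:R * t < sg * dev x w].
(* The absolute value splits into two one-sided tails, which accounts for the factor 2. *)
have EE x : E x = Es x 1 `|` Es x (-1).
  apply/seteqP; rewrite /E /Es; split => w /=; rewrite diffE normrN normrM ger0_norm ?invr_ge0 ?ltW //;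
    rewrite ltr_pdivlMl // ltr_normr mul1r mulN1r.
    by case/orP; [left|right].
  by move=> ?; apply/orP.
have mEs x sg : measurable (Es x sg).
  rewrite -[Es _ _]setTI; apply: (measurable_fun_ltr (measurable_cst _)) => //.
  by apply: measurable_funM => //; exact: measurable_deviation.
have tail x : (P (E x) <= (2 * expR (- (nv%:R * (n%:R + 2) * t ^+ 2)))%:E)%E.
  rewrite EE (le_trans (measureU2 _ _ _)) // mulr_natl mulr2n EFinD.
  have h (sg : R) (sg1 : sg ^+ 2 = 1) := deviation_tail n0 mv uv iv (S x) QTQ sg1 t0.
  by apply: leeD; apply: h; rewrite ?sqrrN expr1n.
split; first exact: tail.
(* The error depends on [x] only through [S x], so the uniform event is the union of the pointwise
   events at the n eigenvalues. *)
have -> : [set w | t < dKS (Phi A) (fun y => nv%:R^-1 * \sum_(i < nv) Psi A (v i w) y)] =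
    \big[setU/set0]_(j <- enum 'I_n) E (dg 0 j).
  rewrite -bigcup_seq; apply/seteqP.
  have key w := @lt_dKS_step R n dg (Phi A) (fun y => nv%:R^-1 * \sum_(i < nv) Psi A (v i w) y).
  have {}key w : t < dKS (Phi A) (fun y => nv%:R^-1 * \sum_(i < nv) Psi A (v i w) y) <->
      exists j, E (dg 0 j) w.
    apply: key => //.
      move=> x y xy; rewrite !diffE /dev; congr `| - (_ * _)|; apply: eq_bigr => i _.
      congr (_ - _%:R / _); first exact: eq_bigl.
      exact: eq_card.
    (* Left of every eigenvalue [S x] is empty and both distributions vanish. *)
    move=> x xd; rewrite diffE /dev big1 ?mulr0 ?oppr0 ?normr0 // => i _.
    have S0 j : S x j = false by apply/negbTE; rewrite /S /= -ltNge xd.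
    by rewrite /sqnorm_on big_pred0 // eq_card0 // mul0r subrr.
  split => w /=; first by move/key => [j Ej]; exists j => //=; rewrite mem_enum.
  by move=> [j _ Ej]; apply/key; exists j.
apply: (le_trans (measure_bigsetU_le _ _ _)).
  by move=> i; rewrite EE; exact: measurableU.
apply: (@le_trans _ _ (\sum_(j <- enum 'I_n) (2 * expR (- (nv%:R * (n%:R + 2) * t ^+ 2)))%:E)%E).
  by apply: lee_sum => j _; exact: tail.
rewrite sumEFin lee_fin big_enum /= sumr_const card_ord -[_ *+ n]mulr_natl.
by rewrite mulrA (mulrC n%:R).
Qed.
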